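(* If $x$ is real with $x>\frac{1+\sqrt2}{2}$ or $x<\frac{1-\sqrt2}{2}$, then $$\sum_{k=1}^\infty\frac{4^k}{k^2[x(1-x)]^k\binom{4k}{2k}}=-2\left(\tanh^{-1}\frac{1}{\sqrt{x}}\right)^{2}-2\left(\tanh^{-1}\frac{1}{\sqrt{1-x}}\right)^2.$$
   Context: Square roots of non-zero complex numbers are $\sqrt z=\sqrt{|z|}\,e^{\frac i2\arg z}$ with $-\pi<\arg z\le\pi$ (so the square root of a negative real number is purely imaginary with positive imaginary part). The function $\tanh^{-1}$ is the principal inverse: $\tanh^{-1}z=\frac12\log\frac{1+z}{1-z}$ with the principal logarithm (so $\tanh^{-1}(iy)=i\tan^{-1}y$ for real $y$). *)

(* Defs.v *)
From Stdlib Require Import Reals Lra.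
From Coquelicot Require Import Coquelicot.
Open Scope R_scope.

Definition Cexp (z : C) : C :=
  (RtoC (exp (Re z)) * (cos (Im z), sin (Im z)))%C.

(* Principal argument, with values in (-PI, PI]; the value at 0 is junk. *)
Definition Carg (z : C) : R :=
  if Rle_dec 0 (Im z) then acos (Re z / Cmod z) else - acos (Re z / Cmod z).

Lemma Carg_spec (z : C) : z <> RtoC 0 ->
  - PI < Carg z <= PI /\ z = (RtoC (Cmod z) * Cexp (Ci * RtoC (Carg z)))%C.
Proof.
intros Hz.
assert (Hm : 0 < Cmod z) by now apply Cmod_gt_0.
assert (Hsq : Cmod z * Cmod z = Re z * Re z + Im z * Im z).
{ unfold Cmod, Re, Im. rewrite sqrt_sqrt; [ring | nra]. }
set (u := Re z / Cmod z). set (v := Im z / Cmod z).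
assert (Huv : u * u + v * v = 1).
{ unfold u, v.
  replace (Re z / Cmod z * (Re z / Cmod z) + Im z / Cmod z * (Im z / Cmod z))
    with ((Re z * Re z + Im z * Im z) / (Cmod z * Cmod z)) by (field; lra).
  rewrite Hsq. field. nra. }
assert (Hu : -1 <= u <= 1) by nra.
assert (Hre : Re z = Cmod z * u) by (unfold u; field; lra).
assert (Him : Im z = Cmod z * v) by (unfold v; field; lra).
assert (Hs : sqrt (1 - Rsqr u) = Rabs v).
{ replace (1 - Rsqr u) with (Rsqr v) by (unfold Rsqr; lra).
  apply sqrt_Rsqr_abs. }
pose proof (acos_bound u) as Hb.
assert (Hcs : cos (Carg z) = u /\ sin (Carg z) = v /\ - PI < Carg z <= PI).
{ pose proof PI_RGT_0. unfold Carg. fold u.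
  destruct (Rle_dec 0 (Im z)) as [Hi|Hi].
  - rewrite cos_acos, sin_acos, Hs, Rabs_pos_eq by (trivial; nra).
    repeat split; lra.
  - assert (Hv : v < 0) by nra.
    rewrite cos_neg, sin_neg, cos_acos, sin_acos, Hs, Rabs_left by trivial.
    assert (acos u <> PI).
    { intros He. assert (Hc := cos_acos u Hu). rewrite He, cos_PI in Hc. nra. }
    repeat split; lra. }
destruct Hcs as (Hc & Hsn & Hr). split; [exact Hr|].
assert (HC : Cexp (Ci * RtoC (Carg z)) = (u, v)).
{ unfold Cexp, Ci, RtoC, Cmult, Re, Im; simpl.
  replace (0 * Carg z - 1 * 0) with 0 by ring.
  replace (0 * 0 + 1 * Carg z) with (Carg z) by ring.
  rewrite exp_0, Hc, Hsn. f_equal; ring. }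
rewrite HC. destruct z as [a b]. unfold RtoC, Cmult.
unfold Re, Im in Hre, Him; simpl in Hre, Him |- *.
f_equal; lra.
Qed.

Definition Cln (z : C) : C := (ln (Cmod z), Carg z).

Definition Csqrt (z : C) : C :=
  (RtoC (sqrt (Cmod z)) * Cexp (Ci / 2 * RtoC (Carg z)))%C.

Definition Catanh (z : C) : C := (1 / 2 * Cln ((1 + z) / (1 - z)))%C.

(* Main.v *)
Require Import Defs.
From Stdlib Require Import Reals Lra Lia.
From Coquelicot Require Import Coquelicot.
Open Scope R_scope.

(** The identity is the real part of the classical expansion
    [S(z) = 2 arcsin^2 (sqrt z) = sum_(k >= 1) (4 z)^k / (k^2 C(2k, k))]
    at a purely imaginary point [z = i w]: there only the even indices [k = 2m]
    contribute to the real part, and they produce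
    [(-16 w^2)^m / (4 m^2 C(4m, 2m))], a quarter of the [m]-th term of the sum
    when [w^2 = 1 / (4 x (x - 1))].

    To evaluate [S (i w)], write [i w = sin^2 (p / 2)], so that
    [S (i w) = p^2 / 2]. The equation [cos p = 1 - 2 i w] is solved by
    [p = gd a + i a], where [gd] is the Gudermannian function and
    [2 w = sinh a tanh a]. Hence the sum is [4 Re (p^2 / 2) = 2 (gd a)^2 - 2 a^2].
    For [x > 1] the right [a] satisfies [tanh a = 1 / sqrt x], and then
    [tan (gd a) = sinh a = 1 / sqrt (x - 1)]; as [sqrt (1 - x) = i sqrt (x - 1)],
    the second inverse hyperbolic tangent is [- i gd a], and its square is
    [- (gd a)^2]. The symmetry [x |-> 1 - x] gives the other ray.

    The proof of [S (sin^2 (p / 2)) = p^2 / 2] stays within real power series,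
    the real and imaginary parts of [h = S'] on the imaginary axis. These satisfy
    the equation [2 z (1 - z) h' + (1 - 2 z) h = 2] ([darcsin2_ode]).
    Along the real curve [t |-> gd t + i t] this equation shows that
    [h sin p - 2 p] is constant ([darcsin2_at_gd]), which in turn gives the
    derivative of [Re S] along the curve ([arcsin2_re_at_gd]). The curve is
    smooth through [t = 0], unlike [sqrt] and [arcsin] at the origin, so the
    constants are fixed by evaluating there. *)

(** * The coefficients of arcsin squared *)

Lemma central_binomial_succ (n : nat) :
  Binomial.C (2 * S n) (S n)
  = Binomial.C (2 * n) n * (2 * (2 * INR n + 1) / (INR n + 1)).
Proof.
  unfold Binomial.C.
  replace (2 * S n - S n)%nat with (S n) by lia.
  replace (2 * n - n)%nat with n by lia.
  replace (2 * S n)%nat with (S (S (2 * n))) by lia.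
  rewrite !fact_simpl, !mult_INR, !S_INR, mult_INR. simpl (INR 2).
  pose proof (pos_INR n). pose proof (INR_fact_neq_0 n).
  field. repeat split; lra.
Qed.

Lemma central_binomial_pos (n : nat) : 0 < Binomial.C (2 * n) n.
Proof.
  unfold Binomial.C. apply Rdiv_lt_0_compat; [apply INR_fact_lt_0|].
  apply Rmult_lt_0_compat; apply INR_fact_lt_0.
Qed.

(** Power series coefficients of [S'], where [S(z) = 2 arcsin^2 (sqrt z)]; the
    recursion is the form in which the differential equation of [S'] uses them. *)
Fixpoint darcsin2_coef (k : nat) : R :=
  match k with
  | O => 2
  | S j => darcsin2_coef j * ((2 * INR j + 2) / (2 * INR j + 3))
  end.

Lemma darcsin2_coef_closed (k : nat) :
  darcsin2_coef k
  = 4 ^ S k / (INR (S k) * Binomial.C (2 * S k) (S k)).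
Proof.
  induction k as [|k IH].
  - unfold Binomial.C; simpl; field.
  - cbn [darcsin2_coef]. rewrite IH, (central_binomial_succ (S k)), <- !tech_pow_Rmult.
    pose proof (central_binomial_pos (S k)). rewrite !S_INR in *.
    pose proof (pos_INR k). field. repeat split; lra.
Qed.

Lemma darcsin2_coef_bound (k : nat) : 0 <= darcsin2_coef k <= 2.
Proof.
  induction k as [|k IH]; cbn [darcsin2_coef]; [lra|].
  pose proof (pos_INR k).
  assert (0 <= (2 * INR k + 2) / (2 * INR k + 3) <= 1).
  { split; [apply Rdiv_le_0_compat; lra|].
    apply Rmult_le_reg_r with (2 * INR k + 3); [lra|].
    unfold Rdiv; rewrite Rmult_assoc, Rinv_l; lra. }
  nra.
Qed.

(** Power series coefficients of [S(z) = 2 arcsin^2 (sqrt z)], that is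
    [4^k / (k^2 C(2k, k))] for [k > 0], obtained by integrating [S'] so that the
    differentiation of [S] is immediate. *)
Definition arcsin2_coef (k : nat) : R :=
  match k with O => 0 | S j => darcsin2_coef j / INR (S j) end.

Lemma arcsin2_coef_bound (k : nat) : 0 <= arcsin2_coef k <= 2.
Proof.
  destruct k as [|j]; [simpl; lra|].
  unfold arcsin2_coef. pose proof (darcsin2_coef_bound j) as Hj.
  pose proof (pos_INR j). rewrite S_INR.
  split; [apply Rdiv_le_0_compat; lra|].
  apply Rmult_le_reg_r with (INR j + 1); [lra|].
  unfold Rdiv; rewrite Rmult_assoc, Rinv_l; nra.
Qed.

(** * Real and imaginary parts on the imaginary axis *)

Lemma bounded_coef_radius (a : nat -> R) (M : R) (w : R) :
  (forall n, Rabs (a n) <= M) -> Rabs w < 1 ->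
  Rbar_lt (Rabs w) (CV_radius a).
Proof.
  intros Ha Hw. apply Rbar_lt_le_trans with 1; [exact Hw|].
  apply (CV_radius_bounded a). exists M. intros n.
  now rewrite pow1, Rmult_1_r.
Qed.

(** When [a] holds the coefficients of [f], [re_twist a] and [im_twist a] hold
    those of the real and imaginary parts of [w |-> f (i w)]. *)
Definition re_twist (a : nat -> R) (k : nat) : R := Re (Cpow Ci k) * a k.
Definition im_twist (a : nat -> R) (k : nat) : R := Im (Cpow Ci k) * a k.

Lemma Re_Ci_pow_succ (k : nat) : Re (Cpow Ci (S k)) = - Im (Cpow Ci k).
Proof. rewrite Cpow_S. unfold Ci, Cmult, Re, Im; simpl. ring. Qed.

Lemma Im_Ci_pow_succ (k : nat) : Im (Cpow Ci (S k)) = Re (Cpow Ci k).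
Proof. rewrite Cpow_S. unfold Ci, Cmult, Re, Im; simpl. ring. Qed.

Lemma Ci_pow_even (m : nat) : Cpow Ci (2 * m) = RtoC ((-1) ^ m).
Proof.
  rewrite Cpow_mult_r, RtoC_pow. f_equal.
  unfold Ci, RtoC; simpl. unfold Cmult; simpl. f_equal; ring.
Qed.

Lemma Ci_pow_bound (k : nat) :
  Rabs (Re (Cpow Ci k)) <= 1 /\ Rabs (Im (Cpow Ci k)) <= 1.
Proof.
  induction k as [|k [IHr IHi]].
  - simpl. rewrite Rabs_R1, Rabs_R0. lra.
  - rewrite Re_Ci_pow_succ, Im_Ci_pow_succ, Rabs_Ropp. now split.
Qed.

Lemma twist_radius (a : nat -> R) (M w : R) :
  (forall n, 0 <= a n <= M) -> Rabs w < 1 ->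
  Rbar_lt (Rabs w) (CV_radius (re_twist a))
  /\ Rbar_lt (Rabs w) (CV_radius (im_twist a)).
Proof.
  intros Ha Hw.
  split; apply (bounded_coef_radius _ M); trivial; intros n;
    unfold re_twist, im_twist; rewrite Rabs_mult;
    destruct (Ci_pow_bound n); destruct (Ha n);
    rewrite (Rabs_pos_eq (a n)) by trivial;
    [pose proof (Rabs_pos (Re (Cpow Ci n)))
    |pose proof (Rabs_pos (Im (Cpow Ci n)))]; nra.
Qed.

(** The recursion says that the coefficients of [w^(k+1)] on the left cancel,
    so only the constant term survives. With [s = 1] and [s = -1] this gives the
    two halves of a complex first-order equation split into real and imaginary
    parts. *)
Lemma pseries_first_order_ode (a b : nat -> R) (s w : R) :
  Rbar_lt (Rabs w) (CV_radius a) -> Rbar_lt (Rabs w) (CV_radius b) ->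
  (forall k, (2 * INR k + 3) * a (S k) + s * (2 * INR k + 2) * b k = 0) ->
  2 * w * (PSeries (PS_derive a) w + s * w * PSeries (PS_derive b) w)
  + PSeries a w + 2 * s * w * PSeries b w = a O.
Proof.
  intros Ha Hb Hrec.
  assert (Ea := CV_radius_inside a w Ha).
  assert (Eb := CV_radius_inside b w Hb).
  assert (Eda : ex_pseries (PS_derive a) w)
    by (apply CV_radius_inside; now rewrite CV_radius_derive).
  assert (Edb : ex_pseries (PS_derive b) w)
    by (apply CV_radius_inside; now rewrite CV_radius_derive).
  assert (Hc : forall (c : R) (u : nat -> R), ex_pseries u w -> ex_pseries (PS_scal c u) w)
    by (intros; apply ex_pseries_scal; [apply Rmult_comm|trivial]).
  assert (Hr : PSeries a w = a O + w * PSeries (PS_decr_1 a) w)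
    by now apply PSeries_decr_1.
  assert (E1 : ex_pseries (PS_decr_1 a) w).
  { apply CV_radius_inside. now rewrite CV_radius_decr_1. }
  assert (Z : PSeries (PS_plus (PS_plus (PS_scal 2 (PS_derive a)) (PS_decr_1 a))
     (PS_scal (2 * s) (PS_plus (PS_incr_1 (PS_derive b)) b))) w = 0).
  { rewrite <- (PSeries_const_0 w). apply PSeries_ext. intros n.
    specialize (Hrec n).
    assert (Hi : PS_incr_1 (PS_derive b) n = INR n * b n)
      by (destruct n; [simpl; symmetry; apply Rmult_0_l|reflexivity]).
    change (2 * (INR (S n) * a (S n)) + a (S n)
            + 2 * s * (PS_incr_1 (PS_derive b) n + b n) = 0).
    rewrite Hi, S_INR. lra. }
  assert (E2 : ex_pseries (PS_incr_1 (PS_derive b)) w)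
    by now apply ex_pseries_incr_1.
  rewrite PSeries_plus in Z;
    [|now apply ex_pseries_plus; [apply Hc|]
     |now apply Hc, ex_pseries_plus].
  rewrite PSeries_plus in Z; [|now apply Hc|trivial].
  rewrite !PSeries_scal in Z.
  rewrite PSeries_plus in Z; [|trivial|trivial].
  rewrite PSeries_incr_1 in Z.
  rewrite Hr.
  replace (a O) with (a O + w * 0) at 2 by ring.
  rewrite <- Z. ring.
Qed.

(** Real and imaginary parts of [S' (i w)] and their derivatives in [w], and the
    real part of [S (i w)]. *)
Definition darcsin2_re (w : R) : R := PSeries (re_twist darcsin2_coef) w.
Definition darcsin2_im (w : R) : R := PSeries (im_twist darcsin2_coef) w.
Definition darcsin2_re' (w : R) : R := PSeries (PS_derive (re_twist darcsin2_coef)) w.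
Definition darcsin2_im' (w : R) : R := PSeries (PS_derive (im_twist darcsin2_coef)) w.
Definition arcsin2_re (w : R) : R := PSeries (re_twist arcsin2_coef) w.

(** Real and imaginary parts of [2 z (1 - z) h' + (1 - 2 z) h = 2] for [h = S'],
    on the line [z = i w]. *)
Lemma darcsin2_ode (w : R) : Rabs w < 1 ->
  2 * w * (darcsin2_re' w + w * darcsin2_im' w)
  + darcsin2_re w + 2 * w * darcsin2_im w = 2
  /\ 2 * w * (darcsin2_im' w - w * darcsin2_re' w)
  + darcsin2_im w - 2 * w * darcsin2_re w = 0.
Proof.
  intros Hw.
  destruct (twist_radius _ _ w darcsin2_coef_bound Hw) as [Hp Hq].
  assert (Hd : forall k, (2 * INR k + 3) * darcsin2_coef (S k)
                         = (2 * INR k + 2) * darcsin2_coef k).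
  { intros k. cbn [darcsin2_coef]. pose proof (pos_INR k). field. lra. }
  split.
  - assert (H := pseries_first_order_ode _ _ 1 w Hp Hq).
    replace (re_twist darcsin2_coef 0) with 2 in H
      by (unfold re_twist; simpl; ring).
    eapply eq_trans; [|apply H];
      [unfold darcsin2_re, darcsin2_im, darcsin2_re', darcsin2_im'; ring|].
    intros k. unfold re_twist, im_twist. rewrite Re_Ci_pow_succ.
    transitivity (- Im (Cpow Ci k) * ((2 * INR k + 3) * darcsin2_coef (S k)
       - (2 * INR k + 2) * darcsin2_coef k)); [ring|rewrite Hd; ring].
  - assert (H := pseries_first_order_ode _ _ (-1) w Hq Hp).
    replace (im_twist darcsin2_coef 0) with 0 in H
      by (unfold im_twist; simpl; ring).
    eapply eq_trans; [|apply H];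
      [unfold darcsin2_re, darcsin2_im, darcsin2_re', darcsin2_im'; ring|].
    intros k. unfold re_twist, im_twist. rewrite Im_Ci_pow_succ.
    transitivity (Re (Cpow Ci k) * ((2 * INR k + 3) * darcsin2_coef (S k)
       - (2 * INR k + 2) * darcsin2_coef k)); [ring|rewrite Hd; ring].
Qed.

(** [d/dw S(i w) = i S'(i w)], whose real part is [- Im S'(i w)]. *)
Lemma is_derive_arcsin2_re (w : R) : Rabs w < 1 -> is_derive arcsin2_re w (- darcsin2_im w).
Proof.
  intros Hw. unfold arcsin2_re.
  destruct (twist_radius _ _ w arcsin2_coef_bound Hw) as [Hu _].
  replace (- darcsin2_im w) with (PSeries (PS_derive (re_twist arcsin2_coef)) w);
    [now apply is_derive_PSeries|].
  unfold darcsin2_im. rewrite <- PSeries_opp. apply PSeries_ext. intros k.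
  change (INR (S k) * (Re (Cpow Ci (S k)) * (darcsin2_coef k / INR (S k)))
          = - (Im (Cpow Ci k) * darcsin2_coef k)).
  rewrite Re_Ci_pow_succ. field. apply not_0_INR. lia.
Qed.

Lemma is_derive_darcsin2_re (w : R) : Rabs w < 1 -> is_derive darcsin2_re w (darcsin2_re' w).
Proof.
  intros Hw. apply is_derive_PSeries.
  apply (twist_radius _ _ _ darcsin2_coef_bound Hw).
Qed.

Lemma is_derive_darcsin2_im (w : R) : Rabs w < 1 -> is_derive darcsin2_im w (darcsin2_im' w).
Proof.
  intros Hw. apply is_derive_PSeries.
  apply (twist_radius _ _ _ darcsin2_coef_bound Hw).
Qed.

(** * The Gudermannian curve *)

Lemma cosh_sqr (t : R) : cosh t * cosh t = 1 + sinh t * sinh t.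
Proof.
  unfold cosh, sinh.
  assert (exp t * exp (- t) = 1) by (rewrite <- exp_plus, Rplus_opp_r; apply exp_0).
  nra.
Qed.

Lemma cosh_gt_0 (t : R) : 0 < cosh t.
Proof. unfold cosh. pose proof (exp_pos t). pose proof (exp_pos (- t)). lra. Qed.

Lemma sinh_incr (s t : R) : s <= t -> sinh s <= sinh t.
Proof.
  intros [H| ->]; [now apply Rlt_le, sinh_lt|apply Rle_refl].
Qed.

(** The [w] for which [i w = sin^2 ((gd t + i t) / 2)]. It follows from
    [2 sin^2 (p / 2) = 1 - cos p], as [cos (gd t + i t) = 1 - i tanh t sinh t]. *)
Definition gd_arg (t : R) : R := sinh t ^ 2 / (2 * cosh t).

Lemma is_derive_sinh (t : R) : is_derive sinh t (cosh t).
Proof. apply is_derive_Reals, derivable_pt_lim_sinh. Qed.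

Lemma is_derive_gd_arg (t : R) :
  is_derive gd_arg t (sinh t * (cosh t ^ 2 + 1) / (2 * cosh t ^ 2)).
Proof.
  pose proof (cosh_gt_0 t). pose proof (cosh_sqr t).
  unfold gd_arg. auto_derive.
  - lra.
  - transitivity (sinh t * (2 * (cosh t * cosh t) - sinh t * sinh t)
                  / (2 * cosh t ^ 2)); [field; lra|].
    f_equal. f_equal. simpl. lra.
Qed.

(** [gd_arg = (cosh - 1 / cosh) / 2] increases on the half-line, so the whole
    arc from [0] to [a] stays inside the disc of convergence. *)
Lemma gd_arg_bound (a t : R) :
  0 <= t <= a -> gd_arg a < 1 -> Rabs (gd_arg t) < 1.
Proof.
  intros Ht Ha. unfold gd_arg in *.
  pose proof (cosh_gt_0 t) as Ct. pose proof (cosh_gt_0 a) as Ca.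
  pose proof (cosh_sqr t) as Et. pose proof (cosh_sqr a) as Ea.
  assert (0 <= sinh t) by (rewrite <- sinh_0; now apply sinh_incr).
  assert (sinh t <= sinh a) by now apply sinh_incr.
  assert (cosh t <= cosh a) by nra.
  assert (Ha' : sinh a ^ 2 < 2 * cosh a).
  { apply Rmult_lt_reg_r with (/ (2 * cosh a)); [apply Rinv_0_lt_compat; lra|].
    rewrite Rinv_r by lra. exact Ha. }
  rewrite Rabs_pos_eq by (apply Rdiv_le_0_compat; nra).
  apply Rmult_lt_reg_r with (2 * cosh t); [lra|].
  unfold Rdiv. rewrite Rmult_assoc, Rinv_l by lra.
  assert (1 <= cosh t) by nra.
  (* This product is (c^2 - 2 c) at c = cosh a minus its value at cosh t, and
     the bounds compare c^2 - 2 c with 1. *)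
  assert (0 <= (cosh a - cosh t) * (cosh a + cosh t - 2))
    by (apply Rmult_le_pos; lra).
  simpl in *. lra.
Qed.

(** The Gudermannian function; [sin (gd t) = tanh t] and
    [cos (gd t) = 1 / cosh t]. *)
Definition gd (t : R) : R := atan (sinh t).

Lemma is_derive_gd (t : R) : is_derive gd t (/ cosh t).
Proof.
  pose proof (cosh_gt_0 t). pose proof (cosh_sqr t).
  replace (/ cosh t) with (scal (cosh t) (/ (1 + Rsqr (sinh t)))).
  - apply (is_derive_comp atan sinh); [apply is_derive_atan|apply is_derive_sinh].
  - change (cosh t * / (1 + Rsqr (sinh t)) = / cosh t).
    unfold Rsqr. rewrite <- H0. field. lra.
Qed.

Lemma constant_of_derive_0 (f : R -> R) (a : R) :
  (forall t, 0 <= t <= a -> is_derive f t 0) -> 0 <= a -> f a = f 0.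
Proof.
  intros H [Ha| <-]; [symmetry; now apply (eq_is_derive f 0 a)|reflexivity].
Qed.

(** With [p = gd t + i t] one has [sin p = sinh t + i tanh t], and the claim is
    [S'(sin^2 (p / 2)) sin p = 2 p]. Both sides vanish at [t = 0]. The derivative
    of their difference is the differential equation of [S'] multiplied by
    [dp/dt = 1 / cosh t + i], so it vanishes; no division by [w] occurs, which is
    why the singular point [w = 0] of the equation does no harm. *)
Lemma darcsin2_at_gd (a : R) : 0 <= a -> gd_arg a < 1 ->
  darcsin2_re (gd_arg a) * sinh a - darcsin2_im (gd_arg a) * (sinh a / cosh a) = 2 * gd a
  /\ darcsin2_re (gd_arg a) * (sinh a / cosh a) + darcsin2_im (gd_arg a) * sinh a = 2 * a.
Proof.
  intros Ha Hw.
  assert (D : forall t, 0 <= t <= a ->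
    is_derive (fun u => darcsin2_re (gd_arg u) * sinh u
                        - darcsin2_im (gd_arg u) * (sinh u / cosh u) - 2 * gd u) t 0
    /\ is_derive (fun u => darcsin2_re (gd_arg u) * (sinh u / cosh u)
                        + darcsin2_im (gd_arg u) * sinh u - 2 * u) t 0).
  { intros t Ht.
    assert (Bt := gd_arg_bound a t Ht Hw).
    pose proof (is_derive_darcsin2_re _ Bt) as Dp. pose proof (is_derive_darcsin2_im _ Bt) as Dq.
    pose proof (is_derive_gd t) as Dg. pose proof (is_derive_gd_arg t) as Dw.
    pose proof (cosh_gt_0 t) as Hc.
    destruct (darcsin2_ode _ Bt) as [O1 O2].
    assert (Ep : Derive (fun u => darcsin2_re u) (gd_arg t) = darcsin2_re' (gd_arg t))
      by exact (is_derive_unique _ _ _ Dp).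
    assert (Eq : Derive (fun u => darcsin2_im u) (gd_arg t) = darcsin2_im' (gd_arg t))
      by exact (is_derive_unique _ _ _ Dq).
    assert (Eg : Derive (fun u => gd u) t = / cosh t)
      by exact (is_derive_unique _ _ _ Dg).
    assert (Ew := is_derive_unique _ _ _ Dw).
    change (Derive (fun u => gd_arg u) t
            = sinh t * (cosh t ^ 2 + 1) / (2 * cosh t ^ 2)) in Ew.
    set (lhs1 := _ + _ + _) in O1. set (lhs2 := _ + _ - _) in O2.
    split.
    - evar_last.
      + auto_derive; [|reflexivity].
        repeat split; try lra; eexists; eassumption.
      + rewrite ?Ep, ?Eq, ?Eg, ?Ew.
        (* real part of (1 / cosh t + i) (lhs1 - 2 + i lhs2) *)
        transitivity (/ cosh t * (lhs1 - 2) - lhs2);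
          [|rewrite O1, O2; ring].
        (* In terms of exp t the relation between cosh and sinh is built in. *)
        unfold lhs1, lhs2, gd_arg, cosh, sinh. rewrite exp_Ropp.
        generalize (exp_pos t). generalize (exp t). intros e He.
        field. nra.
    - evar_last.
      + auto_derive; [|reflexivity].
        repeat split; try lra; eexists; eassumption.
      + rewrite ?Ep, ?Eq, ?Eg, ?Ew.
        (* imaginary part of the same product *)
        transitivity ((lhs1 - 2) + / cosh t * lhs2);
          [|rewrite O1, O2; ring].
        unfold lhs1, lhs2, gd_arg, cosh, sinh. rewrite exp_Ropp.
        generalize (exp_pos t). generalize (exp t). intros e He.
        field. nra. }
  pose proof (constant_of_derive_0 _ a (fun t Ht => proj1 (D t Ht)) Ha) as E1.
  pose proof (constant_of_derive_0 _ a (fun t Ht => proj2 (D t Ht)) Ha) as E2.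
  cbv beta in E1, E2.
  assert (G0 : gd 0 = 0) by (unfold gd; rewrite sinh_0; apply atan_0).
  rewrite G0, sinh_0, cosh_0 in E1. rewrite sinh_0, cosh_0 in E2. lra.
Qed.

(** The real part of [S (sin^2 (p / 2)) = p^2 / 2] for [p = gd a + i a]: along
    the curve both sides have the same derivative, by [darcsin2_at_gd]. *)
Lemma arcsin2_re_at_gd (a : R) : 0 <= a -> gd_arg a < 1 ->
  arcsin2_re (gd_arg a) = (gd a ^ 2 - a ^ 2) / 2.
Proof.
  intros Ha Hw.
  assert (E := fun D => constant_of_derive_0
    (fun u => arcsin2_re (gd_arg u) - (gd u ^ 2 - u ^ 2) / 2) a D Ha).
  cbv beta in E.
  assert (G0 : gd 0 = 0) by (unfold gd; rewrite sinh_0; apply atan_0).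
  assert (W0 : gd_arg 0 = 0) by (unfold gd_arg; rewrite sinh_0, cosh_0; field).
  assert (U0 : arcsin2_re 0 = 0)
    by (unfold arcsin2_re; rewrite PSeries_0; unfold re_twist; simpl; ring).
  rewrite W0, G0, U0 in E. lapply E; [lra|]. clear E.
  intros t Ht.
  assert (Bt := gd_arg_bound a t Ht Hw).
  assert (Bt' : gd_arg t < 1) by (apply Rle_lt_trans with (2 := Bt), Rle_abs).
  destruct (darcsin2_at_gd t (proj1 Ht) Bt') as [E1 E2].
  pose proof (cosh_gt_0 t) as Hc.
  assert (Du := is_derive_arcsin2_re _ Bt). assert (Dw := is_derive_gd_arg t).
  assert (Dg := is_derive_gd t).
  assert (Eu : Derive (fun u => arcsin2_re u) (gd_arg t) = - darcsin2_im (gd_arg t))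
    by exact (is_derive_unique _ _ _ Du).
  assert (Eg : Derive (fun u => gd u) t = / cosh t)
    by exact (is_derive_unique _ _ _ Dg).
  assert (Ew := is_derive_unique _ _ _ Dw).
  change (Derive (fun u => gd_arg u) t
          = sinh t * (cosh t ^ 2 + 1) / (2 * cosh t ^ 2)) in Ew.
  evar_last.
  - auto_derive; [|reflexivity].
    repeat split; try lra; eexists; eassumption.
  - rewrite Eu, Eg, Ew.
    transitivity (- darcsin2_im (gd_arg t) * (sinh t * (cosh t ^ 2 + 1) / (2 * cosh t ^ 2))
      - (2 * gd t / cosh t - 2 * t) / 2); [field; lra|].
    rewrite <- E1, <- E2. field. lra.
Qed.

(** * From the power series to the sum *)

Lemma is_series_even_part (a : nat -> R) (l : R) :
  (forall m, a (2 * m + 1)%nat = 0) -> is_series a l ->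
  is_series (fun m => a (2 * m)%nat) l.
Proof.
  intros Hodd H. unfold is_series in *.
  apply (filterlim_ext (fun n => sum_n a (2 * n + 1))).
  - intros n. induction n as [|n IH].
    + change (2 * 0 + 1)%nat with 1%nat.
      rewrite sum_Sn, !sum_O.
      change (a 1%nat) with (a (2 * 0 + 1)%nat).
      rewrite Hodd. apply Rplus_0_r.
    + replace (2 * S n + 1)%nat with (S (S (2 * n + 1))) by lia.
      rewrite (sum_Sn a (S _)), (sum_Sn a), sum_Sn, IH.
      replace (S (S (2 * n + 1))) with (2 * S n + 1)%nat by lia.
      rewrite (Hodd (S n)). replace (S (2 * n + 1)) with (2 * S n)%nat by lia.
      apply Rplus_0_r.
  - apply (filterlim_comp _ _ _ (fun n => 2 * n + 1)%nat (sum_n a) _ eventually);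
      [|exact H].
    intros V [N HN]. exists N. intros n Hn. apply HN. lia.
Qed.

Lemma is_series_RtoC (a : nat -> R) (l : R) :
  is_series a l ->
  @is_series C_AbsRing C_NormedModule (fun n => RtoC (a n)) (RtoC l).
Proof.
  intros H. unfold is_series in *.
  apply (filterlim_ext (fun n => RtoC (sum_n a n))).
  - intros n. induction n as [|n IH]; [now rewrite !sum_O|].
    rewrite !sum_Sn, <- IH. apply RtoC_plus.
  - apply filterlim_locally. intros eps.
    pose proof (proj1 (filterlim_locally _ _) H eps) as Hl.
    revert Hl. apply filter_imp. intros n Hn. split; [exact Hn|apply ball_center].
Qed.

(** Even powers of [i] are signs, whence the base [-16 w^2 = 4^2 (i w)^2]. *)
Lemma arcsin2_even_term (m : nat) (w : R) :
  let k := S m in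
  re_twist arcsin2_coef (2 * k) * w ^ (2 * k)
  = (-16 * w ^ 2) ^ k / (4 * INR k ^ 2 * Binomial.C (4 * k) (2 * k)).
Proof.
  intros k. unfold re_twist. rewrite Ci_pow_even.
  assert (H : arcsin2_coef (2 * k)
     = 4 ^ (2 * k) / (INR (2 * k) ^ 2 * Binomial.C (4 * k) (2 * k))).
  { pose proof (central_binomial_pos (2 * k)) as Hb.
    replace (4 * k)%nat with (2 * (2 * k))%nat by lia.
    assert (Hk : (2 * k = S (S (2 * m)))%nat) by (unfold k; lia).
    rewrite Hk in *. unfold arcsin2_coef. rewrite darcsin2_coef_closed.
    pose proof (not_0_INR _ (Nat.neq_succ_0 (S (2 * m)))). field. split; lra. }
  rewrite H, !pow_mult, mult_INR. simpl (INR 2).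
  replace (-16 * w ^ 2) with ((-1) * (4 ^ 2 * w ^ 2)) by ring.
  rewrite !Rpow_mult_distr.
  change (Re (RtoC ((-1) ^ k))) with ((-1) ^ k).
  pose proof (central_binomial_pos (2 * k)) as Hb.
  replace (2 * (2 * k))%nat with (4 * k)%nat in Hb by lia.
  pose proof (not_0_INR k (Nat.neq_succ_0 m)).
  field. split; lra.
Qed.

Lemma arcsin2_re_series (w : R) : Rabs w < 1 ->
  is_series (fun n : nat => let k := S n in
    (-16 * w ^ 2) ^ k / (4 * INR k ^ 2 * Binomial.C (4 * k) (2 * k))) (arcsin2_re w).
Proof.
  intros Hw.
  destruct (twist_radius _ _ w arcsin2_coef_bound Hw) as [Hu _].
  assert (H : is_series (fun n => re_twist arcsin2_coef n * w ^ n) (arcsin2_re w)).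
  { apply (is_series_ext (fun n => scal (pow_n w n) (re_twist arcsin2_coef n))).
    - intros n. rewrite pow_n_pow. apply Rmult_comm.
    - apply PSeries_correct, CV_radius_inside, Hu. }
  apply is_series_even_part in H.
  - apply (is_series_ext _ _ _ (fun n => arcsin2_even_term n w)).
    apply (is_series_incr_1 (fun m => re_twist arcsin2_coef (2 * m) * w ^ (2 * m))).
    evar_last; [exact H|].
    unfold re_twist; simpl. unfold plus; simpl. ring.
  - intros m. unfold re_twist. rewrite Nat.add_1_r, Re_Ci_pow_succ, Ci_pow_even.
    simpl. ring.
Qed.

(** * The complex functions at the points of evaluation *)

Lemma Carg_pos (r : R) : 0 < r -> Carg (RtoC r) = 0.
Proof.
  intros Hr. unfold Carg. rewrite Cmod_R, Rabs_pos_eq by lra.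
  change (Re (RtoC r)) with r. change (Im (RtoC r)) with 0.
  replace (r / r) with 1 by (field; lra). rewrite acos_1.
  destruct (Rle_dec 0 0); lra.
Qed.

Lemma Carg_neg (r : R) : 0 < r -> Carg (RtoC (- r)) = PI.
Proof.
  intros Hr. unfold Carg. rewrite Cmod_R, Rabs_Ropp, Rabs_pos_eq by lra.
  change (Re (RtoC (- r))) with (- r). change (Im (RtoC (- r))) with 0.
  replace (- r / r) with (- (1)) by (field; lra). rewrite acos_opp, acos_1.
  destruct (Rle_dec 0 0); lra.
Qed.

Lemma Csqrt_pos (r : R) : 0 < r -> Csqrt (RtoC r) = RtoC (sqrt r).
Proof.
  intros Hr. unfold Csqrt. rewrite Carg_pos, Cmod_R, Rabs_pos_eq by lra.
  replace (Ci / 2 * RtoC 0)%C with (RtoC 0) by ring.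
  unfold Cexp. change (Re (RtoC 0)) with 0. change (Im (RtoC 0)) with 0.
  rewrite exp_0, cos_0, sin_0. change (1, 0) with (RtoC 1). ring.
Qed.

Lemma Csqrt_neg (r : R) : 0 < r -> Csqrt (RtoC (- r)) = (Ci * RtoC (sqrt r))%C.
Proof.
  intros Hr. unfold Csqrt.
  rewrite Carg_neg, Cmod_R, Rabs_Ropp, Rabs_pos_eq by lra.
  replace (Ci / 2 * RtoC PI)%C with (0, PI / 2).
  - unfold Cexp. change (Re (0, PI / 2)) with 0.
    change (Im (0, PI / 2)) with (PI / 2).
    rewrite exp_0, cos_PI2, sin_PI2. change (0, 1) with Ci. ring.
  - replace (Ci / 2 * RtoC PI)%C with (Ci * RtoC (PI / 2))%C.
    + unfold Ci, RtoC, Cmult; simpl. f_equal; ring.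
    + rewrite RtoC_div by lra. field.
Qed.

(** The quotient inside the logarithm is [exp (2 a)]. *)
Lemma Catanh_tanh (a : R) : Catanh (RtoC (sinh a / cosh a)) = RtoC a.
Proof.
  pose proof (cosh_gt_0 a) as Hc.
  pose proof (exp_pos a). pose proof (exp_pos (- a)).
  assert (Hp : cosh a + sinh a = exp a) by (unfold cosh, sinh; lra).
  assert (Hm : cosh a - sinh a = exp (- a)) by (unfold cosh, sinh; lra).
  unfold Catanh.
  replace ((1 + RtoC (sinh a / cosh a)) / (1 - RtoC (sinh a / cosh a)))%C
    with (RtoC (exp (a + a))).
  - unfold Cln. pose proof (exp_pos (a + a)).
    rewrite Carg_pos, Cmod_R, Rabs_pos_eq, ln_exp by lra.
    change (a + a, 0) with (RtoC (a + a)). rewrite RtoC_plus. field.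
  - rewrite <- RtoC_plus, <- RtoC_minus.
    replace (1 + sinh a / cosh a) with (exp a / cosh a)
      by (rewrite <- Hp; field; lra).
    replace (1 - sinh a / cosh a) with (exp (- a) / cosh a)
      by (rewrite <- Hm; field; lra).
    assert (0 < exp (- a) / cosh a) by now apply Rdiv_lt_0_compat.
    rewrite <- RtoC_div by lra. f_equal.
    rewrite exp_plus, exp_Ropp. field. split; lra.
Qed.

(** For [y = tan t] the quotient inside the logarithm is [exp (2 i t)], and [2 t]
    lies in the range of the principal argument. *)
Lemma Catanh_imaginary (y : R) :
  Catanh (RtoC y * Ci) = (RtoC (atan y) * Ci)%C.
Proof.
  set (t := atan y).
  pose proof (atan_bound y) as Ht. fold t in Ht.
  assert (Hc : 0 < cos t) by (apply cos_gt_0; lra).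
  assert (Hy : y = sin t / cos t) by (symmetry; apply (tan_atan y)).
  pose proof (sin2_cos2 t) as H1. unfold Rsqr in H1.
  unfold Catanh.
  replace ((1 + RtoC y * Ci) / (1 - RtoC y * Ci))%C with (cos (2 * t), sin (2 * t)).
  - assert (HL : Cln (cos (2 * t), sin (2 * t)) = (0, 2 * t)).
    { assert (Hm : Cmod (cos (2 * t), sin (2 * t)) = 1).
      { unfold Cmod; simpl. transitivity (sqrt 1); [f_equal|apply sqrt_1].
        pose proof (sin2_cos2 (2 * t)) as H2. unfold Rsqr in H2. lra. }
      unfold Cln, Carg. rewrite Hm, ln_1. f_equal.
      change (Re (cos (2 * t), sin (2 * t))) with (cos (2 * t)).
      change (Im (cos (2 * t), sin (2 * t))) with (sin (2 * t)).
      rewrite Rdiv_1_r. destruct (Rle_dec 0 (sin (2 * t))) as [Hs|Hs].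
      - destruct (Rlt_dec t 0) as [Hn|Hn].
        + exfalso. assert (sin (2 * t) < 0) by (apply sin_lt_0_var; lra). lra.
        + apply acos_cos. lra.
      - destruct (Rlt_dec t 0) as [Hn|Hn].
        + rewrite <- cos_neg, acos_cos by lra. ring.
        + exfalso. apply Hs, sin_ge_0; lra. }
    rewrite HL. unfold Cdiv, Cmult, Cinv, RtoC, Ci; simpl. f_equal; field.
  - assert (Hd : (1 - RtoC y * Ci)%C <> RtoC 0).
    { intros E. apply (f_equal Re) in E.
      unfold Cminus, Cplus, Copp, Cmult, RtoC, Ci, Re in E; simpl in E. lra. }
    assert (Hn : (1 + RtoC y * Ci)%C
                 = ((cos (2 * t), sin (2 * t)) * (1 - RtoC y * Ci))%C).
    { rewrite cos_2a, sin_2a.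
      unfold Cminus, Cplus, Copp, Cmult, RtoC, Ci; simpl. rewrite Hy.
      f_equal.
      - rewrite <- H1 at 1. field. lra.
      - replace (sin t) with (sin t * (sin t * sin t + cos t * cos t)) at 1
          by (rewrite H1; ring).
        field. lra. }
    rewrite Hn. unfold Cdiv. rewrite <- Cmult_assoc, Cinv_r by trivial.
    symmetry. apply Cmult_1_r.
Qed.

(** * The identity *)

(** Choose [a] on the curve with [sinh a = 1 / sqrt (x - 1)]. Then
    [tanh a = 1 / sqrt x] and [tan (gd a) = 1 / sqrt (x - 1)], so [a] and [- i gd a]
    are the two values of the inverse hyperbolic tangent, while
    [-16 (gd_arg a)^2 = 4 / (x (1 - x))] is the base of the powers in the series. *)
Lemma series_value_right (x : R) : x > (1 + sqrt 2) / 2 ->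
  @is_series C_AbsRing C_NormedModule
    (fun n : nat => let k := S n in
       RtoC (4 ^ k /
         (INR k ^ 2 * (x * (1 - x)) ^ k * Binomial.C (4 * k) (2 * k))))
    (- (2) * Cpow (Catanh (1 / Csqrt (RtoC x))) 2
     - 2 * Cpow (Catanh (1 / Csqrt (RtoC (1 - x)))) 2)%C.
Proof.
  intros hx.
  assert (S2 : sqrt 2 * sqrt 2 = 2) by (apply sqrt_sqrt; lra).
  assert (S1 : 1 < sqrt 2) by (rewrite <- sqrt_1; apply sqrt_lt_1; lra).
  assert (Hx : 1 < x) by lra.
  (* The bound on x amounts to (gd_arg a)^2 < 1 for the point a chosen below. *)
  assert (Hx4 : 1 < 4 * (x * (x - 1))) by nra.
  set (u := sqrt x). set (v := sqrt (x - 1)).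
  assert (Hu : 0 < u) by (apply sqrt_lt_R0; lra).
  assert (Hv : 0 < v) by (apply sqrt_lt_R0; lra).
  assert (Hu2 : u * u = x) by (apply sqrt_sqrt; lra).
  assert (Hv2 : v * v = x - 1) by (apply sqrt_sqrt; lra).
  set (a := arcsinh (/ v)).
  assert (Hs : sinh a = / v) by apply sinh_arcsinh.
  assert (Hiv : 0 < / v) by now apply Rinv_0_lt_compat.
  assert (Hc : cosh a = u / v).
  { pose proof (cosh_gt_0 a). pose proof (cosh_sqr a) as E. rewrite Hs in E.
    assert (0 < u / v) by now apply Rdiv_lt_0_compat.
    assert (cosh a * cosh a = u / v * (u / v)).
    { rewrite E. replace (u / v * (u / v)) with (u * u / (v * v)) by (field; lra).
      replace (u * u) with (v * v + 1) by lra. field. lra. }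
    nra. }
  assert (Ha : 0 <= a).
  { destruct (Rle_or_lt 0 a) as [|Hn]; [trivial|].
    apply sinh_lt in Hn. rewrite sinh_0 in Hn. lra. }
  assert (Hw : gd_arg a = / (2 * (u * v))).
  { unfold gd_arg. rewrite Hs, Hc. field. lra. }
  assert (Huv : 0 < u * v) by now apply Rmult_lt_0_compat.
  assert (Hw1 : gd_arg a < 1).
  { rewrite Hw, <- Rinv_1. apply Rinv_lt_contravar; [lra|]. nra. }
  assert (Hval : (- (2) * Cpow (Catanh (1 / Csqrt (RtoC x))) 2
     - 2 * Cpow (Catanh (1 / Csqrt (RtoC (1 - x)))) 2)%C
     = RtoC (4 * arcsin2_re (gd_arg a))).
  { rewrite (arcsin2_re_at_gd a Ha Hw1).
    replace (1 - x) with (- (x - 1)) by ring.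
    rewrite Csqrt_pos, Csqrt_neg by lra. fold u v.
    replace (1 / RtoC u)%C with (RtoC (sinh a / cosh a)).
    2:{ rewrite <- RtoC_div by lra. f_equal. rewrite Hs, Hc. field. lra. }
    replace (1 / (Ci * RtoC v))%C with (RtoC (- sinh a) * Ci)%C.
    2:{ rewrite Hs. unfold Cdiv, Cmult, Cinv, RtoC, Ci; simpl.
        f_equal; field; lra. }
    rewrite Catanh_tanh, Catanh_imaginary, atan_opp. fold (gd a).
    unfold Cminus, Cplus, Copp, Cmult, RtoC, Ci; simpl.
    unfold Cmult; simpl. f_equal; field. }
  rewrite Hval. apply is_series_RtoC.
  assert (HU : is_series _ (scal 4 (arcsin2_re (gd_arg a))))
    by exact (is_series_scal_l 4 _ _
      (arcsin2_re_series _ (gd_arg_bound a a (conj Ha (Rle_refl a)) Hw1))).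
  revert HU. apply is_series_ext. intros n. cbv zeta.
  set (k := S n).
  replace (-16 * gd_arg a ^ 2) with (4 / (x * (1 - x))).
  2:{ rewrite Hw. replace (x * (1 - x)) with (- (u * u * (v * v))) by nra.
      field. lra. }
  pose proof (central_binomial_pos (2 * k)) as Hb.
  replace (2 * (2 * k))%nat with (4 * k)%nat in Hb by lia.
  pose proof (not_0_INR k (Nat.neq_succ_0 n)).
  assert (x * (1 - x) <> 0) by nra.
  pose proof (pow_nonzero (x * (1 - x)) k ltac:(trivial)).
  change (4 * ((4 / (x * (1 - x))) ^ k / (4 * INR k ^ 2 * Binomial.C (4 * k) (2 * k)))
   = 4 ^ k / (INR k ^ 2 * (x * (1 - x)) ^ k * Binomial.C (4 * k) (2 * k))).
  unfold Rdiv at 2. rewrite Rpow_mult_distr, pow_inv.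
  field. repeat split; lra.
Qed.

(* The sum starts at k = 1, whence the shift k = S n; Binomial.C is the
   real-valued binomial coefficient. *)
Theorem theorem1p4 (x : R)
  (hx : x > (1 + sqrt 2) / 2 \/ x < (1 - sqrt 2) / 2) :
  @is_series C_AbsRing C_NormedModule
    (fun n : nat => let k := S n in
       RtoC (4 ^ k /
         (INR k ^ 2 * (x * (1 - x)) ^ k * Binomial.C (4 * k) (2 * k))))
    (- (2) * Cpow (Catanh (1 / Csqrt (RtoC x))) 2
     - 2 * Cpow (Catanh (1 / Csqrt (RtoC (1 - x)))) 2)%C.
Proof.
  (* Both sides are invariant under x |-> 1 - x, which exchanges the two rays. *)
  destruct hx as [hx|hx]; [now apply series_value_right|].
  assert (H : 1 - x > (1 + sqrt 2) / 2) by lra.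
  apply series_value_right in H. replace (1 - (1 - x)) with x in H by ring.
  evar_last.
  - eapply is_series_ext; [|exact H]. intros n. cbv beta zeta.
    now rewrite (Rmult_comm (1 - x) x).
  - cbv beta. ring.
Qed.
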